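(* Let $\mathbb{F}$ be a field, let $V$ be an infinite-dimensional vector space over $\mathbb{F}$, and let $u$ be an endomorphism of $V$ with no dominant eigenvalue. Let $p_1,p_2,p_3\in\mathbb{F}[t]$ be split polynomials of degree $2$. Then $u$ is a $(p_1,p_2,p_3)$-sum.
   Context: For an endomorphism $u$ of an infinite-dimensional vector space $V$, a scalar $\lambda\in\mathbb{F}$ is a dominant eigenvalue of $u$ if $\operatorname{rk}(u-\lambda\,\mathrm{id}_V)<\dim V$. Given polynomials $p_1,\dots,p_n$, an endomorphism $u$ of $V$ is a $(p_1,\dots,p_n)$-sum if there exist endomorphisms $u_1,\dots,u_n$ of $V$ with $u=\sum_{k=1}^n u_k$ and $p_k(u_k)=0$ for all $k$. *)

(* Defs.v *)
From HB Require Import structures.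
From mathcomp Require Import all_boot all_order all_algebra.
From mathcomp Require Import boolp classical_sets functions cardinality.
Set Implicit Arguments. Unset Strict Implicit. Unset Printing Implicit Defensive.
Import Order.TTheory GRing.Theory.
Local Open Scope classical_set_scope.
Local Open Scope ring_scope.

Section LinAlg.
Variables (F : fieldType) (V : lmodType F).

Definition lincomb (s : seq V) (c : nat -> F) : V :=
  \sum_(i < size s) c i *: s`_i.

Definition lin_indep (S : set V) : Prop :=
  forall (s : seq V) (c : nat -> F), uniq s ->
    (forall i, (i < size s)%N -> S s`_i) ->
    lincomb s c = 0 -> forall i, (i < size s)%N -> c i = 0.

Definition lin_span (S : set V) : set V :=
  [set x | exists (s : seq V) (c : nat -> F),
      (forall i, (i < size s)%N -> S s`_i) /\ x = lincomb s c].

Definition is_basis (W B : set V) : Prop :=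
  B `<=` W /\ lin_indep B /\ W `<=` lin_span B.

Definition infinite_dim : Prop :=
  ~ exists s : seq V, [set: V] `<=` lin_span [set x | x \in s].

Definition rank_lt_dim (f : V -> V) : Prop :=
  exists B C : set V, is_basis (range f) B /\ is_basis [set: V] C /\
    ((B #<= C)%card /\ ~ (C #<= B)%card).

Definition dominant_eigenvalue (u : V -> V) (lambda : F) : Prop :=
  rank_lt_dim (fun x => u x - lambda *: x).

Definition poly_annihilates (p : {poly F}) (f : V -> V) : Prop :=
  forall x : V, \sum_(i < size p) p`_i *: iter i f x = 0.

Definition is_sum3 (p1 p2 p3 : {poly F}) (u : V -> V) : Prop :=
  exists u1 u2 u3 : {linear V -> V},
    (forall x, u x = u1 x + u2 x + u3 x) /\
    poly_annihilates p1 u1 /\ poly_annihilates p2 u2 /\ poly_annihilates p3 u3.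
End LinAlg.

Definition split_deg2 (F : fieldType) (p : {poly F}) : Prop :=
  size p = 3%N /\
  exists a b : F, p = lead_coef p *: (('X - a%:P) * ('X - b%:P)).

(* Main.v *)
Require Import Defs.
From HB Require Import structures.
From mathcomp Require Import all_boot all_order all_algebra.
From mathcomp Require Import boolp classical_sets functions cardinality.
From mathcomp Require wochoice.
From mathcomp Require Import ring.
Set Implicit Arguments. Unset Strict Implicit. Unset Printing Implicit Defensive.
Import GRing.Theory.
Local Open Scope classical_set_scope.

(** Write p_k = c_k (t - a_k)(t - b_k). If V = A + B is a direct sum, then
    [[a_1, 0], [Y, b_1]] and [[b_2, Z], [0, a_2]] are annihilated by p_1 and p_2
    whatever Y and Z are, so only the diagonal blocks P and S of u matter: it is
    enough that P and gamma - S be similar through an isomorphism Phi : A -> B, where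
    gamma = a_1 + b_1 + a_2 + b_2 + a_3 + b_3. The third summand is then conjugate,
    through Phi, to a matrix with identity upper right corner.

    The absence of a dominant eigenvalue provides a set X with dim V elements such
    that the vectors x and u x, for x in X, are independent: if X is maximal and W is
    the span of these vectors, then some u - lambda maps V into W + u W. Let
    A = span X and complete to a basis of V by a set L containing u X. The vectors
    l - xi l, for l in L, span a complement B of A for any injection xi : L -> X.
    Then P acts on X as the injection xi o u, while S is the opposite of the shift
    l |-> u (xi l) plus an arbitrary column-finite matrix. If u o xi grows fast enough
    for a suitable well-ordering of L, then gamma - S is triangularly equivalent to
    that shift, which is isomorphic to xi o u by a Cantor-Schroeder-Bernstein argument. *)

(** * Well-orders and filtrations with countable layers *)

Lemma well_founded_total_order (T : eqType) : exists lt : T -> T -> Prop,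
  [/\ well_founded lt, (forall x y z, lt x y -> lt y z -> lt x z) &
      forall x y, [\/ lt x y, x = y | lt y x]].
Proof.
have [R woR] := wochoice.well_ordering_principle T.
have woT : wochoice.wo_chain R predT := wochoice.withinW woR.
have Rtot x y : R x y || R y x by exact: (wochoice.wo_chainW woT).
have Ranti x y : R x y -> R y x -> x = y.
  by move=> xy yx; apply: (wochoice.wo_chain_antisymmetric woT) => //; rewrite xy.
have Rmin (P : set T) x : P x -> exists2 m, P m & forall y, P y -> R m y.
  move=> Px; have /woR[m [[Pm mP] _]] : nonempty (fun y => `[< P y >]).
    by exists x; apply/asboolP.
  exists m; first by move: Pm; rewrite unfold_in => /asboolP.
  by move=> y Py; apply: mP; rewrite unfold_in; apply/asboolP.
have Rtrans x y z : R x y -> R y z -> R x z.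
  move=> xy yz; have [|m mxyz mle] := Rmin [set t | [\/ t = x, t = y | t = z]] x.
    by constructor 1.
  case: mxyz mle => [-> h|-> h|-> h]; first by apply: h; constructor 3.
    by rewrite (Ranti x y) // h //; constructor 1.
  have zy : z = y by apply: Ranti => //; apply: h; constructor 2.
  by rewrite zy.
exists (fun x y => R x y /\ x <> y); split.
- move=> x; apply: contrapT => nx.
  have [m nm mle] := Rmin (fun z => ~ Acc (fun x y => R x y /\ x <> y) z) x nx.
  apply: nm; constructor => y [ym nym]; apply: contrapT => /mle my.
  by apply: nym; apply: Ranti.
- move=> x y z [xy nxy] [yz nyz]; split; first exact: Rtrans yz.
  by move=> xz; subst z; apply: nxy; apply: Ranti.
- move=> x y; have [->|nxy] := pselect (x = y); first by constructor 2.
  have /orP[xy|yx] := Rtot x y; [constructor 1|constructor 3]; split=> //.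
  by move=> yx'; apply: nxy.
Qed.

Lemma well_founded_min (T : Type) (lt : T -> T -> Prop) (P : set T) x :
  well_founded lt -> P x -> exists2 m, P m & forall y, P y -> ~ lt y m.
Proof.
move=> wf; elim/(well_founded_ind wf): x => x IH Px.
have [[y [Py yx]]|h] := pselect (exists y, P y /\ lt y x); first exact: IH yx Py.
by exists x => // y Py yx; apply: h; exists y.
Qed.

Lemma countableU T (A B : set T) : countable A -> countable B -> countable (A `|` B).
Proof.
move=> cA cB; have -> : A `|` B = \bigcup_(b in [set: bool]) (if b then A else B).
  apply/seteqP; split=> x; first by case=> ?; [exists true|exists false].
  by move=> [[] _ ?]; [left|right].
by apply: bigcup_countable => // -[] _.
Qed.

Lemma countable_closure (T : Type) (R : T -> set T) (x : T) :
  (forall y, countable (R y)) ->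
  exists C : set T, [/\ countable C, C x & forall y, C y -> R y `<=` C].
Proof.
move=> cR; pose D := fix D n := if n is k.+1 then \bigcup_(y in D k) R y else [set x].
exists (\bigcup_n D n); split.
- apply: bigcup_countable => // n _.
  by elim: n => [|n IH]; [exact: countable1 | exact: bigcup_countable].
- by exists 0%N.
- by move=> y [n _ Dny] z yz; exists n.+1 => //; exists y.
Qed.

(* The rank of [x] is the least point whose countable [R]-closure contains [x]. *)
Lemma countable_filtration (T : eqType) (R : T -> set T) :
  (forall y, countable (R y)) ->
  exists (lt : T -> T -> Prop) (r : T -> T) (q : T -> nat),
  [/\ well_founded lt, (forall x y z, lt x y -> lt y z -> lt x z),
      (forall x y, [\/ lt x y, x = y | lt y x]),
      (forall x y, R x y -> ~ lt (r x) (r y)) &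
      forall x y, r x = r y -> q x = q y -> x = y].
Proof.
move=> cR; have [lt [wf trans tot]] := well_founded_total_order T.
have /choice[C HC] : forall x, exists C : set T,
    [/\ countable C, C x & forall y, C y -> R y `<=` C].
  by move=> x; exact: countable_closure.
have /choice[r Hr] : forall x, exists m, C m x /\ forall y, C y x -> ~ lt y m.
  move=> x; have [m Cm mmin] := well_founded_min (P := fun m => C m x) wf
    (let: And3 _ h _ := HC x in h).
  by exists m.
have /choice[c Hc] : forall k, exists c : T -> nat,
    forall x y, C k x -> C k y -> c x = c y -> x = y.
  move=> k; have [/countable_injP[c cinj] _ _] := HC k.
  by exists c => x y Cx Cy; apply: cinj; rewrite inE.
(* [c k] enumerates the closure of [k], so it separates the points of rank [k]. *)
exists lt, r, (fun x => c (r x) x); split=> //.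
- move=> x y xy; have [_ _ Ccl] := HC (r x).
  by apply: (Hr y).2; apply: Ccl xy; apply: (Hr x).1.
- move=> x y rxy qxy; apply: (Hc (r x)); first exact: (Hr x).1.
    by rewrite rxy; exact: (Hr y).1.
  by rewrite qxy rxy.
Qed.

(** * Injections into infinite sets *)

Lemma card_le_inj T (U : choiceType) (A : set T) (B : set U) (u : U) :
  (A #<= B)%card -> exists2 f : T -> U, (forall x, A x -> B (f x)) &
    forall x y, A x -> A y -> f x = f y -> x = y.
Proof.
pose U' : pointedType := HB.pack U (isPointed.Build U u).
move=> /(@pcard_leP T U' A B)[f]; exists f; first by move=> x; apply: funS.
by move=> x y Ax Ay; apply: (@inj _ _ _ f); rewrite inE.
Qed.

Lemma infinite_set_inj (T : choiceType) (X : set T) : infinite_set X ->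
  exists2 f : nat -> T, (forall n, X (f n)) & injective f.
Proof.
move=> iX; have [x _] := infinite_setN0 iX.
have [f fX finj] := card_le_inj x (proj1 (infiniteP X) iX).
by exists f => [n|n m]; [apply: fX | apply: finj].
Qed.

(** A maximal disjoint family [E] of injective sequences in [X] misses only finitely many points of
    [X]. Each point is coded by a member of [E] and a natural number, and this number can absorb the
    second factor. *)
Lemma infinite_prod_nat_inj (T : choiceType) (X : set T) : infinite_set X ->
  exists2 g : T -> nat -> T, (forall x n, X x -> X (g x n)) &
    forall x y n m, X x -> X y -> g x n = g y m -> x = y /\ n = m.
Proof.
move=> infX.
pose D := [set j : nat -> T | injective j /\ forall n, X (j n)].
have [E [ED Etriv Emax]] :=
  ex_maximal_disjoint_subcollection (fun j : nat -> T => range j) D.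
pose U := \bigcup_(j in E) range j.
have finXU : finite_set (X `\` U).
  apply: contrapT => /infinite_set_inj[f fXU finj].
  have nEf : ~ E f by move=> Ef; case: (fXU 0%N) => _; apply; exists f => //; exists 0%N.
  apply: (Emax (E `|` [set f])).
  - by split; [move=> j; left|move=> /(_ f)h; apply: nEf; apply: h; right].
  - by move=> j [/ED//|->]; split=> // n; case: (fXU n).
  - have disj j : E j -> forall z, range j z -> ~ range f z.
      by move=> Ej z jz [n _ fn]; case: (fXU n) => _; apply; exists j => //; rewrite fn.
    move=> i j [Ei|->] [Ej|->]; first exact: Etriv.
    + by move=> [z [iz fz]]; case: (disj i Ei z iz).
    + by move=> [z [fz jz]]; case: (disj j Ej z jz).
    + by [].
have [j0 Ej0] : exists j, E j.
  apply: contrapT => nE; apply: infX; apply: sub_finite_set finXU => x Xx; split=> //.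
  by move=> [j Ej _]; apply: nE; exists j.
have /countable_injP[c cinj] := finite_set_countable finXU.
have Einj i j n m : E i -> E j -> i n = j m -> i = j /\ n = m.
  move=> Ei Ej e; have ij : i = j.
    by apply: Etriv => //; exists (i n); split; [exists n|exists m].
  by split=> //; subst j; apply: (ED i Ei).1.
(* Even numbers code the position of a point inside its sequence; odd ones code the finitely many
   points outside [U], all attached to [j0]. *)
have /choice[k Hk] : forall x, exists p : (nat -> T) * nat, X x -> E p.1 /\
    ((U x /\ exists n, p.2 = n.*2 /\ p.1 n = x) \/
     (~ U x /\ p.2 = (c x).*2.+1)).
  move=> x; have [[j Ej [n _ jn]]|nUx] := pselect (U x).
    by exists (j, n.*2) => _; split=> //; left; split; [exists j => //; exists n|exists n].
  by exists (j0, (c x).*2.+1) => _; split=> //; right.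
exists (fun x n => (k x).1 (pickle ((k x).2, n))).
  by move=> x n Xx; have [/ED[_ h] _] := Hk x Xx; apply: h.
move=> x y n m Xx Xy; have [Ex hx] := Hk x Xx; have [Ey hy] := Hk y Xy.
move=> /(Einj _ _ _ _ Ex Ey)[e1 /(pcan_inj pickleK)[e2 ->]]; split=> //.
case: hx hy => [[Ux [a [ea <-]]]|[Ux ea]] [[Uy [b [eb <-]]]|[Uy eb]].
- by rewrite e1; move: e2; rewrite ea eb => /double_inj ->.
- by move: e2; rewrite ea eb => /(congr1 odd); rewrite /= !odd_double.
- by move: e2; rewrite ea eb => /(congr1 odd); rewrite /= !odd_double.
- move: e2; rewrite ea eb => -[/double_inj]; apply: cinj; rewrite inE; split=> //.
Qed.

Local Open Scope ring_scope.
(** Compactness for the Zorn arguments: a dependence relation in the union of a chain involves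
    finitely many vectors, hence a single member of the chain. *)
Lemma chain_seq (T : eqType) (A : set (set T)) (s : seq T) :
  total_on A subset -> A !=set0 -> (forall x, x \in s -> exists2 C, A C & C x) ->
  exists2 C, A C & forall x, x \in s -> C x.
Proof.
move=> tA [C0 AC0]; elim: s => [|x s IH] h; first by exists C0.
have [C AC Cs] : exists2 C, A C & forall x, x \in s -> C x.
  by apply: IH => y ys; apply: h; rewrite inE ys orbT.
have [D AD Dx] := h x (mem_head _ _).
have [CD|DC] := tA _ _ AC AD; [exists D|exists C] => // y; rewrite inE.
  by move=> /orP[/eqP->|/Cs/CD].
by move=> /orP[/eqP->|/Cs] //; exact: DC.
Qed.

(** * Spans, independence, bases and linear extension *)

Section Span.
Variables (F : fieldType) (V : lmodType F).
Implicit Types (S X : set V) (x y z v w : V) (a b c : F).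

(** The inductive form gives induction on linear combinations without lists of coefficients. The end
    of the section passes from it to [lin_span], and from [indep] to [lin_indep]. *)
Inductive spanned S : V -> Prop :=
| spanned0 : spanned S 0
| spanned_cons a x v : S x -> spanned S v -> spanned S (a *: x + v).

Definition indep S := forall x, S x -> ~ spanned (S `\ x) x.

Lemma spanned_incl S x : S x -> spanned S x.
Proof.
move=> Sx; rewrite -[x]scale1r -[_ *: _]addr0.
by apply: spanned_cons => //; apply: spanned0.
Qed.

Lemma spannedD S x y : spanned S x -> spanned S y -> spanned S (x + y).
Proof.
elim=> [|a s v Ss _ IH] Sy; first by rewrite add0r.
by rewrite -addrA; apply: spanned_cons; auto.
Qed.

Lemma spannedZ S a x : spanned S x -> spanned S (a *: x).
Proof.
elim=> [|b s v Ss _ IH]; first by rewrite scaler0; apply: spanned0.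
by rewrite scalerDr scalerA; apply: spanned_cons.
Qed.

Lemma spannedN S x : spanned S x -> spanned S (- x).
Proof. by rewrite -scaleN1r; apply: spannedZ. Qed.

Lemma spannedB S x y : spanned S x -> spanned S y -> spanned S (x - y).
Proof. by move=> Sx Sy; apply: spannedD => //; apply: spannedN. Qed.

Lemma spannedBr S x y : spanned S (x - y) -> spanned S y -> spanned S x.
Proof. by move=> Sxy Sy; rewrite -(subrK y x); apply: spannedD. Qed.

Lemma spannedZr S a x : a != 0 -> spanned S (a *: x) -> spanned S x.
Proof. by move=> a0 Sx; rewrite -[x](scalerK a0); apply: spannedZ. Qed.

Lemma spanned_sum S (I : Type) (s : seq I) (P : pred I) (f : I -> V) :
  (forall i, P i -> spanned S (f i)) -> spanned S (\sum_(i <- s | P i) f i).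
Proof. by move=> h; apply: big_ind => //; [apply: spanned0 | apply: spannedD]. Qed.

Lemma spanned_sub S X :
  (forall x, S x -> spanned X x) -> forall x, spanned S x -> spanned X x.
Proof.
move=> h x; elim=> [|a s v Ss _ IH]; first exact: spanned0.
by apply: spannedD => //; apply/spannedZ/h.
Qed.

Lemma spanned_mono S X : S `<=` X -> forall x, spanned S x -> spanned X x.
Proof. by move=> SX; apply: spanned_sub => x /SX; apply: spanned_incl. Qed.

Lemma spanned_setU1 S x y : spanned (S `|` [set x]) y -> exists c, spanned S (y - c *: x).
Proof.
elim=> [|a s v Ss _ [c IH]]; first by exists 0; rewrite scale0r subr0; apply: spanned0.
case: Ss => [Ss|->].
  by exists c; rewrite -addrA; apply: spanned_cons.
by exists (a + c); rewrite scalerDl opprD addrACA subrr add0r.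
Qed.

Lemma spanned_seq S x : spanned S x -> exists s : seq V,
  (forall y, y \in s -> S y) /\ spanned [set y | y \in s] x.
Proof.
elim=> [|a s v Ss _ [t [tS tv]]]; first by exists [::]; split=> //; apply: spanned0.
exists (s :: t); split; first by move=> y; rewrite inE => /orP[/eqP->|/tS].
apply: spanned_cons; first by rewrite /= inE eqxx.
by apply: spanned_mono tv => y /=; rewrite inE => ->; rewrite orbT.
Qed.

Lemma spanned_pairs S x : spanned S x -> exists l : seq (F * V),
  (forall p, p \in l -> S p.2) /\ x = \sum_(p <- l) p.1 *: p.2.
Proof.
elim=> [|a s v Ss _ [l [lS ->]]]; first by exists [::]; rewrite big_nil.
exists ((a, s) :: l); rewrite big_cons; split=> // p.
by rewrite inE => /orP[/eqP->|/lS].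
Qed.

Lemma indep_sum S (s : seq V) (f : V -> F) : indep S -> uniq s ->
  (forall x, x \in s -> S x) -> \sum_(x <- s) f x *: x = 0 ->
  forall x, x \in s -> f x = 0.
Proof.
move=> iS us sS s0 x xs; apply/eqP; apply: contrapT => /negP fx.
apply: (iS x (sS x xs)); apply: (spannedZr fx).
move: s0; rewrite (bigD1_seq x) //= => /eqP; rewrite addr_eq0 => /eqP ->.
apply: spannedN; rewrite big_seq_cond; apply: spanned_sum => y /andP[ys yx].
by apply/spannedZ/spanned_incl; split; [exact: sS | exact/eqP].
Qed.

(** Exchange: a relation expressing [y] through [x] with a nonzero coefficient can be solved for
    [x]. *)
Lemma indep_setU1 S x : indep S -> ~ spanned S x -> indep (S `|` [set x]).
Proof.
move=> iS nx y [Sy|->] h; last first.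
  by apply: nx; apply: spanned_mono h => z [[Sz|->] zx] //; case: zx.
have /spanned_setU1[c hc] : spanned ((S `\ y) `|` [set x]) y.
  by apply: spanned_mono h => z [[Sz|->] zx]; [left|right].
have [c0|c0] := eqVneq c 0.
  by apply: (iS y Sy); move: hc; rewrite c0 scale0r subr0.
apply: nx; apply: (spannedZr c0).
rewrite -[_ *: _]opprK; apply: spannedN.
rewrite -(addKr y (- _)); apply: spannedD; last by apply: spanned_mono hc => z [].
by apply/spannedN/spanned_incl.
Qed.

Lemma basis_extension S0 (W : set V) : indep S0 -> S0 `<=` W ->
  exists B, [/\ S0 `<=` B, B `<=` W, indep B & forall x, W x -> spanned B x].
Proof.
move=> iS0 S0W.
(* Zorn is applied to the set [C] added to [S0] rather than to supersets of [S0]: the empty chain,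
   whose union is empty, must also satisfy [P]. *)
pose P := [set C : set V | C `<=` W /\ indep (S0 `|` C)].
have [|C [[CW iC] Cmax]] := @Zorn_bigcup V P.
  move=> A AP tA; split; first by apply: bigcup_sub => C /AP[].
  have [A0|nA] := pselect (A !=set0); last first.
    have -> : S0 `|` \bigcup_(C in A) C = S0; last by [].
    by apply/seteqP; split=> [x [//|[C AC _]]|x ?]; [case: nA; exists C | left].
  move=> x Sx /spanned_seq[s [sS sx]].
  have [|C AC hC] := @chain_seq _ A [seq y <- x :: s | `[< ~ S0 y >]] tA A0.
    move=> y; rewrite mem_filter inE => /andP[/asboolP nS0 /orP[/eqP yx|/sS[]]].
      by move: Sx; rewrite -yx => -[//|[C AC Cy]]; exists C.
    by move=> [//|[C AC Cy]] _; exists C.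
  have mem y : y \in x :: s -> (S0 `|` C) y.
    move=> ys; have [|nS0] := pselect (S0 y); first by left.
    by right; apply: hC; rewrite mem_filter ys andbT; apply/asboolP.
  have [_ iSC] := AP _ AC; apply: (iSC x); first by apply: mem; rewrite mem_head.
  apply: spanned_mono sx => y ys; split; last by have [] := sS _ ys.
  by apply: mem; rewrite inE ys orbT.
exists (S0 `|` C); split=> //; first by move=> x [/S0W|/CW].
move=> x Wx; apply: contrapT => nx; apply: (Cmax (C `|` [set x])).
  split; first by move=> y; left.
  by move=> /(_ x (or_intror erefl)) Cx; apply: nx; apply: spanned_incl; right.
split; first by move=> y [/CW|->].
by rewrite setUA; apply: indep_setU1.
Qed.

(** Merges the terms with equal vectors, because [indep_sum] requires a duplicate-free list. *)
Lemma sum_pairs_undup (V' : lmodType F) (phi : V -> V') (l : seq (F * V)) :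
  \sum_(p <- l) p.1 *: phi p.2 =
  \sum_(x <- undup (map snd l)) (\sum_(p <- l | p.2 == x) p.1) *: phi x.
Proof.
under [RHS]eq_bigr => x _ do rewrite scaler_suml.
rewrite (exchange_big_dep predT) //= big_seq [RHS]big_seq; apply: eq_bigr => p pl.
rewrite -big_filter (@perm_big _ _ _ _ _ [:: p.2]) ?big_seq1 //.
apply: uniq_perm => //; first by rewrite filter_uniq ?undup_uniq.
move=> x; rewrite mem_filter mem_undup inE [p.2 == x]eq_sym.
by case: eqP => //= ->; apply: map_f.
Qed.

(** The graph [G] of the extension is a linear relation. Independence of [S] leaves 0 as its only
    value at 0, so it is functional; the spanning hypothesis makes it total. *)
Lemma linear_extension (V' : lmodType F) S (phi : V -> V') :
  indep S -> (forall x, spanned S x) ->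
  exists f : {linear V -> V'}, forall x, S x -> f x = phi x.
Proof.
move=> iS gS.
pose G v (w : V') := exists l : seq (F * V), [/\ forall p, p \in l -> S p.2,
  v = \sum_(p <- l) p.1 *: p.2 & w = \sum_(p <- l) p.1 *: phi p.2].
have G0 (w : V') : G 0 w -> w = 0.
  move=> [l [lS l0 ->]]; rewrite sum_pairs_undup big_seq big1 // => x xl.
  rewrite (@indep_sum S (undup [seq p.2 | p <- l])
    (fun x => \sum_(p <- l | p.2 == x) p.1)) ?scale0r ?undup_uniq //.
    by move=> y; rewrite mem_undup => /mapP[p pl ->]; apply: lS.
  by rewrite -(sum_pairs_undup id).
have GD a v (w : V') v' (w' : V') : G v w -> G v' w' -> G (a *: v + v') (a *: w + w').
  move=> [l [lS -> ->]] [l' [lS' -> ->]].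
  exists ([seq (a * p.1, p.2) | p <- l] ++ l'); split.
  - by move=> p; rewrite mem_cat => /orP[/mapP[q /lS qS ->]|/lS'].
  - rewrite big_cat big_map scaler_sumr /=; congr (_ + _).
    by apply: eq_bigr => p _; rewrite scalerA.
  - rewrite big_cat big_map scaler_sumr /=; congr (_ + _).
    by apply: eq_bigr => p _; rewrite scalerA.
have Gfun v (w w' : V') : G v w -> G v w' -> w = w'.
  move=> h h'; apply/eqP; rewrite -subr_eq0; apply/eqP/G0.
  by have := GD (-1) _ _ _ _ h' h; rewrite !scaleN1r addNr addrC.
have /choice[f Hf] : forall v, exists w : V', G v w.
  move=> v; have [l [lS ->]] := spanned_pairs (gS v).
  by exists (\sum_(p <- l) p.1 *: phi p.2), l.
have flin : linear f by move=> a v w; apply: Gfun (Hf _) _; apply: GD.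
pose lf := GRing.isLinear.Build F V V' *:%R f flin.
pose fL : {linear V -> V'} := HB.pack f lf.
exists fL => x Sx /=; apply: Gfun (Hf _) _; exists [:: (1, x)].
by rewrite !big_seq1 !scale1r; split=> // p; rewrite inE => /eqP ->.
Qed.

Lemma linear_spanned (V' : lmodType F) (f : {linear V -> V'}) S (P : set V') :
  P 0 -> (forall a (v w : V'), P v -> P w -> P (a *: v + w)) ->
  (forall x, S x -> P (f x)) -> forall x, spanned S x -> P (f x).
Proof.
move=> P0 PD Pf x; elim=> [|a s v Ss _ IH]; first by rewrite linear0.
by rewrite linearP; apply: PD => //; apply: Pf.
Qed.

Lemma linear_eq_spanned (V' : lmodType F) (f g : {linear V -> V'}) S :
  (forall x, S x -> f x = g x) -> forall x, spanned S x -> f x = g x.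
Proof.
move=> fg x; elim=> [|a s v Ss _ IH]; first by rewrite !linear0.
by rewrite !linearP IH fg.
Qed.

Lemma indep_lin_indep S : indep S -> lin_indep S.
Proof.
move=> iS s c us sS s0 i ilt.
rewrite -(index_uniq 0 ilt us).
apply: (@indep_sum S s (fun x => c (index x s))) => //; last exact: mem_nth.
  by move=> x /(nthP 0)[j jlt <-]; apply: sS.
transitivity (lincomb s c) => //; rewrite /lincomb (big_nth 0) big_mkord.
apply: eq_bigr => j _.
by rewrite index_uniq.
Qed.

Lemma spanned_lin_span S x : spanned S x -> lin_span S x.
Proof.
elim=> [|a y v Sy _ [s [c [sS ->]]]].
  by exists [::], (fun=> 0); split=> //; rewrite /lincomb big_ord0.
exists (y :: s), (fun i => if i is j.+1 then c j else a); split; first by case.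
by rewrite /lincomb big_ord_recl.
Qed.

End Span.

(** * Quadratic relations and two-by-two block decompositions *)

Section Quadratic.
Variables (F : fieldType) (V : lmodType F).

(** The relation (f - a)(f - b) = 0, read as: [f] is multiplication by [a] on the image of
    [f - b]. *)
Definition quadratic (a b : F) (f : V -> V) :=
  forall x, f (f x - b *: x) = a *: (f x - b *: x).

Lemma split_deg2_quadratic (p : {poly F}) : split_deg2 p ->
  exists a b, forall f : {linear V -> V}, quadratic a b f -> poly_annihilates p f.
Proof.
move=> [sp [a [b ep]]]; exists a, b => f fq x.
rewrite sp !big_ord_recl big_ord0 /= addr0 /bump /= !add1n.
set c := lead_coef p in ep.
have [-> -> ->] : [/\ p`_0 = c * (a * b), p`_1 = - (c * (a + b)) & p`_2 = c].
  have -> : p = (c * (a * b))%:P - (c * (a + b))%:P * 'X + c%:P * 'X^2.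
    by rewrite ep -mul_polyC !polyCM polyCD; ring.
  by rewrite !(coefD, coefN, coefCM, coefC, coefX, coefXn) /=; split; ring.
have ffx : f (f x) = (a + b) *: f x - (a * b) *: x.
  have := fq x; rewrite linearB linearZ /= => /eqP; rewrite subr_eq => /eqP ->.
  by rewrite scalerBr scalerA scalerDl addrAC.
by rewrite ffx scaleNr scalerBr !scalerA !addrA subrK subrr.
Qed.

Section Blocks.
(** [kap] is the projection onto B along its kernel A. [Phi] and [Psi] are inverse isomorphisms
    between A and B, extended by 0 to the other summand, and [Phi_u] is the similarity between P and
    [gam] - S. *)
Variables (u kap Phi Psi : {linear V -> V}) (a1 b1 a2 b2 a3 b3 : F).
Let gam := a1 + b2 + (b1 + a2) + (a3 + b3).
Hypothesis kapK : forall x, kap (kap x) = kap x.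
Hypothesis kapPhi : forall x, kap (Phi x) = Phi x.
Hypothesis Psikap : forall x, Psi (kap x) = Psi x.
Hypothesis kapPsi : forall x, kap (Psi x) = 0.
Hypothesis PhiK : forall x, Psi (Phi x) = x - kap x.
Hypothesis PsiK : forall x, Phi (Psi x) = kap x.
Hypothesis Phi_u : forall x, kap x = 0 ->
  Phi (u x) = gam *: Phi x - kap (u (Phi x)).

Let pi : V -> V := idfun \- kap.
Let al := a1 + b2.
Let be := b1 + a2.
(** [u3 - b3] factors as [j] after [w], with [w] valued in A. The upper blocks of [u3] are thereby P
    - [al] and [Psi]. *)
Let w : {linear V -> V} := (pi \o u \o pi) \- ((al + b3) \*: pi) \+ Psi.
(* [w + Phi ((a3 - P) w)], with [P] the upper left block of [u3]: these vectors, for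
   [w] in the first summand, form the image of [u3 - b3]. *)
Let j : {linear V -> V} := idfun \+ (((a3 + al) \*: Phi) \- (Phi \o u)).
Let u3 : {linear V -> V} := (b3 \*: idfun) \+ (j \o w).
(** The diagonal blocks of [D] turn out to be the scalars [al] and [be], so that [D] splits into the
    triangular maps [u1] and [u2]. *)
Let D : {linear V -> V} := u \- u3.
Let u1 : {linear V -> V} := (a1 \*: pi) \+ (b1 \*: kap) \+ (kap \o D \o pi).
Let u2 : {linear V -> V} := (b2 \*: pi) \+ (a2 \*: kap) \+ (pi \o D \o kap).

Lemma quadratic_decomposition : exists v1 v2 v3 : {linear V -> V},
  [/\ forall x, u x = v1 x + v2 x + v3 x,
      quadratic a1 b1 v1, quadratic a2 b2 v2 & quadratic a3 b3 v3].
Proof.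
have piE x : pi x = x - kap x by [].
have kappi x : kap (pi x) = 0 by rewrite piE linearB /= kapK subrr.
have pikap x : pi (kap x) = 0 by rewrite piE kapK subrr.
have pipi x : pi (pi x) = pi x by rewrite [LHS]piE kappi subr0.
have kZ a x : kap (a *: x) = a *: kap x by exact: linearZ.
have PZ a x : Psi (a *: x) = a *: Psi x by exact: linearZ.
have kapD x y : kap (x + y) = kap x + kap y by exact: linearD.
have DZ a x : D (a *: x) = a *: D x by exact: linearZ.
have jZ a x : j (a *: x) = a *: j x by exact: linearZ.
have wE x : w x = pi (u (pi x)) - (al + b3) *: pi x + Psi x by [].
have jE x : j x = x + ((a3 + al) *: Phi x - Phi (u x)) by [].
have u3E x : u3 x = b3 *: x + j (w x) by [].
have DE x : D x = u x - u3 x by [].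
have u1E x : u1 x = a1 *: pi x + b1 *: kap x + kap (D (pi x)) by [].
have u2E x : u2 x = b2 *: pi x + a2 *: kap x + pi (D (kap x)) by [].
have piD x y : pi (x + y) = pi x + pi y by rewrite !piE linearD opprD addrACA.
have piB x y : pi (x - y) = pi x - pi y by rewrite !piE linearB !opprD opprK addrACA.
have piZ a x : pi (a *: x) = a *: pi x by rewrite !piE linearZ /= scalerBr.
have piA x : kap x = 0 -> pi x = x by rewrite piE => ->; rewrite subr0.
have piPhi x : pi (Phi x) = 0 by rewrite piE kapPhi subrr.
have PsiA x : kap x = 0 -> Psi x = 0 by move=> kx; rewrite -Psikap kx linear0.
have kapw x : kap (w x) = 0.
  by rewrite wE linearD linearB linearZ /= !kappi kapPsi scaler0 subr0 addr0.
have pij x : pi (j x) = pi x by rewrite jE piD piB piZ !piPhi scaler0 subr0 addr0.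
have kapj x : kap x = 0 -> kap (j x) = (a3 + al) *: Phi x - Phi (u x).
  by move=> kx; rewrite jE linearD linearB linearZ /= !kapPhi kx add0r.
have pi3 x : kap x = 0 -> pi (u3 x) = pi (u x) - al *: x.
  move=> kx; rewrite u3E piD piZ pij (piA _ (kapw x)) wE (PsiA _ kx) addr0 (piA _ kx).
  rewrite scalerDl opprD.
  by rewrite addrCA; congr (_ + _); rewrite addrCA subrr addr0.
(* The lower right block of [D] is scalar exactly because of the similarity [Phi_u]. *)
have kap3 x : kap (D (kap x)) = be *: kap x.
  have pi0 : pi 0 = 0 by rewrite piE linear0 subr0.
  have wx : w (kap x) = Psi x.
    by rewrite wE pikap (linear0 u) pi0 scaler0 subr0 add0r Psikap.
  rewrite DE linearB u3E linearD kZ kapK wx (kapj _ (kapPsi x)) PsiK Phi_u // PsiK.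
  rewrite /gam -/al -/be; set y := kap x; set z := kap (u y).
  have -> : al + be + (a3 + b3) = (b3 + (a3 + al)) + be by ring.
  rewrite (scalerDl y (b3 + _)) (scalerDl y b3).
  set P := b3 *: y; set Q := (a3 + al) *: y; set R := be *: y.
  rewrite (addrA P Q); set S := P + Q.
  by rewrite opprB [_ - z - S]addrAC [S + R]addrC addrK addrCA subrr addr0.
have xE x : x = pi x + kap x by rewrite piE subrK.
have xZ a x : a *: x = a *: pi x + a *: kap x by rewrite -scalerDr -xE.
have piDpi x : pi (D (pi x)) = al *: pi x.
  by rewrite DE piB (pi3 _ (kappi x)) opprB addrC subrK.
exists u1, u2, u3; split.
- move=> x; rewrite -[LHS](subrK (u3 x)) -DE; congr (_ + _).
  have -> : D x = (al *: pi x + kap (D (pi x))) + (pi (D (kap x)) + be *: kap x).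
    by rewrite -piDpi -kap3 -!xE -linearD -xE.
  rewrite u1E u2E !scalerDl.
  by rewrite (AC ((2*1)*(1*2)) ((1*5*3)*(2*6*4))).
- move=> x; have e : u1 x - b1 *: x = (a1 - b1) *: pi x + kap (D (pi x)).
    by rewrite u1E (xZ b1 x) scalerBl opprD [X in X + _]addrAC addrACA subrr addr0 addrAC.
  rewrite e u1E piD piZ pipi pikap addr0 kapD kZ kappi scaler0 add0r kapK DZ kZ.
  by rewrite [RHS]scalerDr -addrA -scalerDl [b1 + _]addrC subrK.
- move=> x; have e : u2 x - b2 *: x = (a2 - b2) *: kap x + pi (D (kap x)).
    by rewrite u2E (xZ b2 x) scalerBl opprD -[X in X + _]addrA addrACA subrr add0r addrAC.
  rewrite e u2E piD piZ pipi pikap scaler0 add0r kapD kZ kappi addr0 kapK DZ piZ.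
  by rewrite [RHS]scalerDr addrAC -scalerDl [b2 + _]addrC subrK addrC.
- move=> x; have -> : u3 x - b3 *: x = j (w x) by rewrite u3E addrC addKr.
  (* [w] after [j] is the scalar [a3 - b3] on A, so the square of [u3 - b3] is [a3 - b3] times
     itself. *)
  have wj : w (j (w x)) = (a3 - b3) *: w x.
    rewrite wE pij (piA _ (kapw x)) -Psikap (kapj _ (kapw x)).
    rewrite linearB PZ !PhiK kapw subr0 -piE.
    by rewrite addrC addrA subrK -scalerBl; congr (_ *: _); ring.
  by rewrite u3E wj jZ -scalerDl addrC subrK.
Qed.


End Blocks.
End Quadratic.

(** * Maps with countable fibres and comparison of bases *)

Definition countable_to_one T U (A : set T) (B : set U) :=
  exists (f : T -> U) (q : T -> nat), (forall x, A x -> B (f x)) /\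
    forall x y, A x -> A y -> f x = f y -> q x = q y -> x = y.

Lemma countable_to_one_trans T U W (A : set T) (B : set U) (C : set W) :
  countable_to_one A B -> countable_to_one B C -> countable_to_one A C.
Proof.
move=> [f [q [fAB fq]]] [g [p [gBC gp]]].
exists (g \o f), (fun x => pickle (q x, p (f x))); split=> [x /fAB/gBC//|x y Ax Ay /= gfxy].
move=> /(pcan_inj pickleK)[qxy pxy]; apply: fq => //.
by apply: gp => //; apply: fAB.
Qed.

Lemma countable_to_one_sub T (A B : set T) : A `<=` B -> countable_to_one A B.
Proof. by move=> AB; exists id, (fun=> 0%N). Qed.

Lemma countable_to_one_card_le T (U : choiceType) (A : set T) (B : set U) (u : U) :
  (A #<= B)%card -> countable_to_one A B.
Proof.
move=> /(card_le_inj u)[f fAB finj]; exists f, (fun=> 0%N); split=> // x y Ax Ay fxy _.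
exact: finj.
Qed.

(** Countable fibres are harmless over an infinite target: the factor [nat] absorbs both the fibre
    index [q x] and [n]. *)
Lemma countable_to_one_prod_nat T (U : choiceType) (A : set T) (B : set U) :
  infinite_set B -> countable_to_one A B ->
  exists2 g : T -> nat -> U, (forall x n, A x -> B (g x n)) &
    forall x y n m, A x -> A y -> g x n = g y m -> x = y /\ n = m.
Proof.
move=> /infinite_prod_nat_inj[g gB ginj] [f [q [fAB fq]]].
exists (fun x n => g (f x) (pickle (q x, n))) => [x n /fAB/gB//|x y n m Ax Ay].
move=> /(ginj _ _ _ _ (fAB _ Ax) (fAB _ Ay))[fxy /(pcan_inj pickleK)[qxy ->]].
by split=> //; apply: fq.
Qed.

Section Dimension.
Variables (F : fieldType) (V : lmodType F).
Implicit Types (S X B G W : set V) (x y z v w b : V).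

Lemma spanned_coordinates (s : seq V) x : spanned [set y | y \in s] x ->
  exists c : 'I_(size s) -> F, x = \sum_i c i *: s`_i.
Proof.
elim=> [|a y v /= ys _ [c ->]].
  by exists (fun=> 0); rewrite big1 // => i _; rewrite scale0r.
have ylt : (index y s < size s)%N by rewrite index_mem.
exists (fun i => (if i == Ordinal ylt then a else 0) + c i).
under [RHS]eq_bigr => i _ do rewrite scalerDl.
rewrite big_split /=; congr (_ + _).
rewrite (bigD1 (Ordinal ylt)) //= eqxx nth_index // big1 ?addr0 // => i /negPf ->.
by rewrite scale0r.
Qed.

Lemma indep_finite B (s : seq V) : indep B ->
  (forall b, B b -> spanned [set y | y \in s] b) -> finite_set B.
Proof.
move=> iB Bs; apply: contrapT => /infinite_set_inj[f fB finj].
have /choice[c Hc] : forall n, exists c : 'I_(size s) -> F, f n = \sum_i c i *: s`_i.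
  by move=> n; apply/spanned_coordinates/Bs.
(* With one more vector than the length of [s], the coordinate matrix has a nonzero left kernel. *)
pose n := (size s).+1.
pose M := \matrix_(i < n, j < size s) c i j.
have : kermx M != 0.
  rewrite kermx_eq0 /row_free; apply: contraTneq (rank_leq_col M) => ->.
  by rewrite -ltnNge.
move=> /rowV0Pn[k /sub_kermxP kM] /eqP; apply; apply/rowP => i; rewrite mxE.
pose t := mkseq f n.
have ut : uniq t by rewrite map_inj_uniq ?iota_uniq.
have fi (j : 'I_n) : index (f j) t = j.
  by rewrite -[in LHS](nth_mkseq 0 f (ltn_ord j)) index_uniq ?size_mkseq.
pose h x := if insub (index x t) is Some j then k 0 j else 0.
have hf (j : 'I_n) : h (f j) = k 0 j by rewrite /h fi valK.
rewrite -hf; apply: (@indep_sum _ _ B t) => //.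
- by move=> x /mapP[j _ ->].
- rewrite big_map -[iota 0 n]/(index_iota 0 n) big_mkord.
  under eq_bigr => j _ do rewrite hf Hc scaler_sumr.
  rewrite exchange_big big1 //= => l _.
  under eq_bigr => j _ do rewrite scalerA.
  rewrite -scaler_suml; have /rowP/(_ l) := kM; rewrite !mxE.
  by under eq_bigr => j _ do rewrite mxE; move=> ->; rewrite scale0r.
- by apply: map_f; rewrite mem_iota leq0n add0n ltn_ord.
Qed.

(* Filter [V] by the closures under taking supports in [B] and in [G]; both sets
   spanned each layer, so a layer meeting [B] also meets [G]. *)
Lemma basis_countable_to_one B G : indep B ->
  (forall x, B x -> spanned G x) -> (forall x, G x -> spanned B x) ->
  countable_to_one B G.
Proof.
move=> iB BG GB.
have supp S x : exists s : seq V, spanned S x ->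
    (forall y, y \in s -> S y) /\ spanned [set y | y \in s] x.
  have [/spanned_seq[s hs]|nS] := pselect (spanned S x); first by exists s.
  by exists [::].
have /choice[sG HG] := supp G; have /choice[sB HB] := supp B.
have [|lt [r [q [wf trans tot Rr rq]]]] :=
    @countable_filtration V (fun x => [set y | y \in sG x] `|` [set y | y \in sB x]).
  by move=> x; apply: countableU; exact/finite_set_countable/finite_seq.
have irr x : ~ lt x x.
  by elim/(well_founded_ind wf): x => x IH xx; apply: (IH x).
(* Otherwise the support of [b] in [G] lies in strictly lower layers, and so do the supports in [B]
   of its elements; [b] would then be spanned by other elements of [B]. *)
have meet b : B b -> exists g, G g /\ r g = r b.
  move=> Bb; apply: contrapT => nG; apply: (iB b Bb).
  have [sGG sGb] := HG b (BG b Bb).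
  apply: spanned_sub sGb => g /= gs; have Gg := sGG g gs.
  have [sBB sBg] := HB g (GB g Gg).
  apply: spanned_mono sBg => b' /= b's; split; first exact: sBB.
  move=> /= b'b; apply: nG; exists g; split=> //.
  have h1 := Rr b g (or_introl gs); have h2 := Rr g b' (or_intror b's).
  by rewrite b'b in h2; case: (tot (r g) (r b)).
have /choice[f Hf] : forall b, exists g, B b -> G g /\ r g = r b.
  move=> b; have [/meet[g hg]|nB] := pselect (B b); first by exists g.
  by exists 0.
exists f, q; split; first by move=> b /Hf[].
move=> x y Bx By fxy; apply: rq; have [_ <-] := Hf x Bx; have [_ <-] := Hf y By.
by rewrite fxy.
Qed.

End Dimension.

(** * Maximal families of independent pairs x, u x *)

Section FreePairs.
Variables (F : fieldType) (V : lmodType F) (u : {linear V -> V}).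
Implicit Types (X : set V) (x y z v w : V) (a b c : F).

Definition with_image X := X `|` u @` X.

(** Independence as a family of pairs. Independence of the set [with_image X] would be weaker: it
    allows [u] to identify points of [X] or to send one into [X]. *)
Definition free_pairs X := forall x, X x ->
  forall a b, spanned (with_image (X `\ x)) (a *: x + b *: u x) -> a = 0 /\ b = 0.

Lemma with_image_sub X Y : X `<=` Y -> with_image X `<=` with_image Y.
Proof. by move=> XY x [/XY|[y /XY Yy <-]]; [left|right; exists y]. Qed.

Lemma free_pairs_indep X : free_pairs X -> indep (with_image X).
Proof.
move=> fX y0 [Xy0|[x Xx <-]] h.
  move: y0 Xy0 h => x Xx h.
  have [|c hc] := @spanned_setU1 _ _ (with_image (X `\ x)) (u x) x.
    apply: spanned_mono h => y [[Xy|[z Xz <-]] yx]; first by left; left.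
    by have [->|zx] := pselect (z = x); [right|left; right; exists z].
  have [|/eqP] := fX x Xx 1 (- c); first by rewrite scale1r scaleNr.
  by rewrite oner_eq0.
have [|c hc] := @spanned_setU1 _ _ (with_image (X `\ x)) x (u x).
  apply: spanned_mono h => y [[Xy|[z Xz <-]] yx].
    by have [->|zx] := pselect (y = x); [right|left; left].
  by left; right; exists z => //; split=> // zx; apply: yx; rewrite zx.
have [|_ /eqP] := fX x Xx (- c) 1; first by rewrite scale1r scaleNr addrC.
by rewrite oner_eq0.
Qed.

Lemma free_pairs_inj X x y : free_pairs X -> X x -> X y -> u x = u y -> x = y.
Proof.
move=> fX Xx Xy uxy; apply: contrapT => nxy.
have [|_ /eqP] := fX x Xx 0 1; last by rewrite oner_eq0.
rewrite scale0r add0r scale1r; apply: spanned_incl; right; exists y => //.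
by split=> // yx; apply: nxy.
Qed.

Lemma free_pairs_disjoint X x y : free_pairs X -> X x -> X y -> u x <> y.
Proof.
move=> fX Xx Xy uxy; have [yx|nyx] := pselect (y = x).
  have [|/eqP] := fX x Xx 1 (- 1); last by rewrite oner_eq0.
  by rewrite uxy yx scaleN1r scale1r subrr; apply: spanned0.
have [|_ /eqP] := fX x Xx 0 1; last by rewrite oner_eq0.
by rewrite scale0r add0r scale1r uxy; apply: spanned_incl; left.
Qed.

Lemma free_pairs_setU1 X z : free_pairs X ->
  (forall a b, spanned (with_image X) (a *: z + b *: u z) -> a = 0 /\ b = 0) ->
  free_pairs (X `|` [set z]).
Proof.
move=> fX hz x [Xx|->] a b h; last first.
  by apply: hz; apply: spanned_mono h; apply: with_image_sub => y [[Xy|->] yz] //; case: yz.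
pose S := with_image (X `\ x).
have [|c hc] := @spanned_setU1 _ _ (S `|` [set z]) (u z) (a *: x + b *: u x).
  apply: spanned_mono h => y [[[Xy|->] yx]|[t [[Xt|->] tx] <-]].
  - by left; left; left.
  - by left; right.
  - by left; left; right; exists t.
  - by right.
have [d hd] := spanned_setU1 hc.
have SX : S `<=` with_image X by apply: with_image_sub => y [].
have [|d0 c0] := hz d c.
  set p := a *: x + b *: u x in hd.
  have -> : d *: z + c *: u z = p - (p - c *: u z - d *: z).
    by rewrite -[p - _ - _]addrA -opprD opprB addrCA subrr addr0 addrC.
  apply: spannedB; last exact: (spanned_mono SX).
  apply: spannedD; apply/spannedZ/spanned_incl; first by left.
  by right; exists x.
by apply: (fX x Xx); move: hd; rewrite d0 c0 !scale0r !subr0.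
Qed.

(** By Zorn: a vector [z] outside the span for which no [c] exists could be added to a maximal
    [X]. *)
Lemma maximal_free_pairs : exists X, free_pairs X /\
  forall z, ~ spanned (with_image X) z ->
    exists c, spanned (with_image X) (u z - c *: z).
Proof.
have [|X [fX Xmax]] := @Zorn_bigcup V free_pairs.
  move=> A Afree tA x [C0 AC0 C0x] a b /spanned_seq[s [sX sab]].
  (* [t y] is the point of the union from which the support vector [y] comes, as itself or as its
     image. *)
  have /choice[t Ht] : forall y, exists z, y \in s ->
      [/\ (\bigcup_(C in A) C) z, z <> x & y = z \/ y = u z].
    move=> y; have [/sX|] := boolP (y \in s); last by exists 0.
    case=> [[Xy yx]|[z [Xz zx] <-]]; first by exists y => _; split=> //; left.
    by exists z => _; split=> //; right.
  have [||C AC Ct] := @chain_seq _ A (x :: map t s) tA; first by exists C0.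
    move=> y; rewrite inE => /orP[/eqP->|/mapP[z zs ->]]; first by exists C0.
    by have [[C AC Cz] _ _] := Ht z zs; exists C.
  apply: (Afree C AC x); first by apply: Ct; rewrite mem_head.
  apply: spanned_mono sab => y ys; have [_ tx yt] := Ht y ys.
  have Cty : (C `\ x) (t y) by split=> //; apply: Ct; rewrite inE map_f ?orbT.
  by case: yt => ->; [left|right; exists (t y)].
exists X; split=> // z nz; apply: contrapT => nc.
apply: (Xmax (X `|` [set z])).
  split; first by move=> y; left.
  by move=> /(_ z (or_intror erefl)) Xz; apply: nz; apply: spanned_incl; left.
apply: free_pairs_setU1 => // a b h.
have b0 : b = 0.
  apply/eqP; apply: contrapT => /negP b0; apply: nc; exists (- (a / b)).
  apply: (spannedZr b0); rewrite scaleNr opprK scalerDr scalerA mulrCA divff // mulr1.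
  by rewrite addrC.
split=> //; apply/eqP; apply: contrapT => /negP a0; apply: nz; apply: (spannedZr a0).
by move: h; rewrite b0 scale0r addr0.
Qed.

Lemma spanned_with_image_range X :
  (forall z, ~ spanned (with_image X) z ->
    exists c, spanned (with_image X) (u z - c *: z)) ->
  exists c, forall v,
    spanned (with_image X `|` u @` with_image X) (u v - c *: v).
Proof.
move=> hX; set W := with_image X; set G := W `|` u @` W.
have WG v : spanned W v -> spanned G v by apply: spanned_mono => y; left.
have WuG c v : spanned W v -> spanned G (u v - c *: v).
  move=> Wv; apply: spannedB; last by apply/spannedZ/WG.
  apply: (@linear_spanned _ _ _ u W (spanned G)) Wv; first exact: spanned0.
    by move=> a s t Gs Gt; apply: spannedD => //; apply: spannedZ.
  by move=> x Wx; apply: spanned_incl; right; exists x.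
have [allW|/existsNP[z0 nz0]] := pselect (forall v, spanned W v).
  by exists 0 => v; apply/WuG/allW.
have [c hc] := hX z0 nz0; exists c => v.
have uD x y : u (x + y) - c *: (x + y) = (u x - c *: x) + (u y - c *: y).
  by rewrite linearD scalerDr opprD addrACA.
have [Wv|nWv] := pselect (spanned W v); first exact: WuG.
have [Ws|nWs] := pselect (spanned W (v + z0)).
  apply: (@spannedBr _ _ G _ (- (u z0 - c *: z0))); last by apply/spannedN/WG.
  by rewrite opprK -uD; apply: WuG.
have [b hb] := hX v nWv; have [d hd] := hX _ nWs.
have hbc : spanned W ((d - b) *: v + (d - c) *: z0).
  have -> : (d - b) *: v + (d - c) *: z0 =
      (u v - b *: v) + (u z0 - c *: z0) - (u (v + z0) - d *: (v + z0)).
    rewrite (linearD u) !scalerBl scalerDr [RHS]addrC opprB.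
    by rewrite [u v - _ + _]addrACA addrA subrK addrACA.
  by apply: spannedB => //; apply: spannedD.
have [bd|bd] := eqVneq (d - b) 0.
  have [cd|cd] := eqVneq (d - c) 0.
    apply: WG; have -> // : c = b.
    by apply: (@oppr_inj F); apply: (@addrI F d); rewrite bd cd.
  case: nz0; apply: (spannedZr cd); move: hbc; by rewrite bd scale0r add0r.
(* Here [v] is proportional to [z0] modulo the span of [W], so the scalar of [z0] serves for [v]. *)
pose t := (d - b)^-1 * (d - c).
have Wt : spanned W (v + t *: z0).
  apply: (spannedZr bd); by rewrite scalerDr scalerA mulrA divff // mul1r.
rewrite -[v](addrK (t *: z0)) uD; apply: spannedD; first exact: WuG.
rewrite linearN scalerN -opprD; apply: spannedN.
rewrite linearZ /= scalerA [c * t]mulrC -(scalerA t) -scalerBr.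
by apply/spannedZ/WG.
Qed.

End FreePairs.

(** * Free pairs of full cardinality *)

Section LargeFreePairs.
Variables (F : fieldType) (V : lmodType F) (u : {linear V -> V}).

Lemma countable_to_one_with_image (X : set V) :
  countable_to_one (with_image u X `|` u @` with_image u X) X.
Proof.
have /choice[f Hf] : forall y, exists p : V * nat,
    (with_image u X `|` u @` with_image u X) y -> X p.1 /\ y = iter p.2 u p.1.
  move=> y; have [h|nh] := pselect ((with_image u X `|` u @` with_image u X) y);
    last by exists (0, 0%N).
  case: h => [[Xy|[x Xx <-]]|[t [tX|[x Xx <-]] <-]].
  - by exists (y, 0%N).
  - by exists (x, 1%N).
  - by exists (t, 1%N).
  - by exists (x, 2%N).
exists (fst \o f), (snd \o f); split=> [y /Hf[]//|x y /Hf[_ hx] /Hf[_ hy] /= e1 e2].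
by rewrite hx hy e1 e2.
Qed.

(** [X] and its first two images under [u] span the range of some [u - c], which has full dimension
    since [c] is not dominant. A basis [E] of the space thus maps to [X] with countable fibres. *)
Lemma large_free_pairs : infinite_dim V ->
  (forall lambda : F, ~ dominant_eigenvalue u lambda) ->
  exists X E : set V, exists g : V -> nat -> V,
  [/\ free_pairs u X, with_image u X `<=` E, indep E & forall v, spanned E v] /\
  [/\ (forall x n, E x -> X (g x n)) &
      forall x y n m, E x -> E y -> g x n = g y m -> x = y /\ n = m].
Proof.
move=> infV ndom; have [X [fX Xmax]] := maximal_free_pairs u.
have [c Gc] := spanned_with_image_range Xmax.
set G := _ `|` _ in Gc; pose f v := u v - c *: v.
have i0 : indep (set0 : set V) by [].
have [B [_ Bf iB fB]] := basis_extension i0 (sub0set (range f)).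
have [C [BC _ iC VC]] := basis_extension iB (@subsetT _ B).
have CB : (C #<= B)%card.
  apply: contrapT => nCB; apply: (ndom c); exists B, C; split; [|split].
  - by split=> //; split; [exact: indep_lin_indep | move=> x /fB/spanned_lin_span].
  - by split=> //; split; [exact: indep_lin_indep | move=> x _; apply/spanned_lin_span/VC].
  - by split=> //; apply: subset_card_le.
have BG : B `<=` [set v | spanned G v] by move=> x /Bf[v _ <-]; apply: Gc.
have [D [BD DG iD GD]] := basis_extension iB BG.
have [E [XE _ iE VE]] := basis_extension (free_pairs_indep fX) (@subsetT _ _).
(* The chain goes from [E] to [C], both bases of [V], then to [B] by [CB], to [D], a basis of the
   span of [G], then to [G] and [X]. *)
have EX : countable_to_one E X.
  apply: countable_to_one_trans (countable_to_one_with_image X).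
  apply: (@countable_to_one_trans _ _ _ _ D).
    apply: (@countable_to_one_trans _ _ _ _ C).
      by apply: basis_countable_to_one => // x _; [apply: VC | apply: VE].
    apply: countable_to_one_trans (countable_to_one_sub BD).
    exact: countable_to_one_card_le 0 CB.
  by apply: basis_countable_to_one => // x Gx; apply/GD/spanned_incl.
(* If [X] were finite, so would be [G], then [B], then the basis [C] of [V]. *)
have infX : infinite_set X.
  move=> /finite_seqP[s Xs]; apply: infV.
  have Gs y : G y -> y \in s ++ map u s ++ map (u \o u) s.
    rewrite /G /with_image Xs !mem_cat.
    move=> [[/= ->//|[x /= xs <-]]|[t [/= ts|[x /= xs <-]] <-]].
    - by rewrite map_f ?orbT.
    - by rewrite map_f ?orbT.
    - by rewrite (map_f (u \o u) xs) !orbT.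
  have finB : finite_set B.
    by apply: (indep_finite iB) => b /BG /=; apply: spanned_mono => y; apply: Gs.
  have /finite_seqP[t Ct] := card_le_finite CB finB.
  by exists t => v _; apply: spanned_lin_span; rewrite -Ct; apply: VC.
have [g gX ginj] := countable_to_one_prod_nat infX EX.
by exists X, E, g; split; split=> // v; apply: VE.
Qed.

End LargeFreePairs.

(** * Lexicographic orders and an equivariant Cantor-Schroeder-Bernstein theorem *)

Lemma well_founded_lex (T U : Type) (lt : U -> U -> Prop) (r : T -> U) (q : T -> nat) :
  well_founded lt ->
  well_founded (fun x y => lt (r x) (r y) \/ r x = r y /\ (q x < q y)%N).
Proof.
move=> wf; suff h k : forall n x, r x = k -> (q x < n)%N ->
    Acc (fun x y => lt (r x) (r y) \/ r x = r y /\ (q x < q y)%N) x.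
  by move=> x; apply: (h (r x) (q x).+1).
elim/(well_founded_ind wf): k => k IHk; elim=> [//|n IHn] x rx qx.
constructor => y [ryx|[ryx qyx]].
  by apply: (IHk (r y) _ (q y).+1) => //; rewrite -rx.
by apply: IHn; [rewrite ryx | apply: leq_trans qyx _; rewrite -ltnS].
Qed.

Lemma injective_nat_unbounded (f : nat -> nat) N : injective f ->
  exists n, (N < f n)%N.
Proof.
move=> finj; apply: contrapT => h.
have : (size (mkseq f N.+2) <= size (iota 0 N.+1))%N.
  apply: uniq_leq_size; first by rewrite map_inj_uniq ?iota_uniq.
  move=> _ /mapP[n _ ->]; rewrite mem_iota /= add0n ltnS leqNgt.
  by apply/negP => Nf; apply: h; exists n.
by rewrite size_mkseq size_iota ltnn.
Qed.

(** The usual bijection is already equivariant. [Z] collects the points whose backward chain starts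
    in [L] outside the image of [f]; [lam] inverts [xi] on [Z] and is [f] elsewhere, and [x] is in
    [Z] exactly when [xi (f x)] is. *)
Lemma equivariant_schroeder_bernstein (T : choiceType) (X L : set T) (f xi : T -> T) :
  (forall x, X x -> L (f x)) -> (forall l, L l -> X (xi l)) ->
  (forall x y, X x -> X y -> f x = f y -> x = y) ->
  (forall l m, L l -> L m -> xi l = xi m -> l = m) ->
  exists lam lam' : T -> T,
  [/\ forall x, X x -> L (lam x), forall l, L l -> X (lam' l),
      forall x, X x -> lam' (lam x) = x, forall l, L l -> lam (lam' l) = l &
      forall x, X x -> lam (xi (f x)) = f (xi (lam x))].
Proof.
move=> fL xiX finj xinj.
pose Z x := exists n k, [/\ L k, forall y, X y -> f y <> k &
                           x = iter n (xi \o f) (xi k)].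
have ZX x : Z x -> X x.
  by move=> [n [k [Lk _ ->]]]; elim: n => [|n IH] /=; auto.
have ZL x : Z x -> exists2 l, L l & xi l = x.
  move=> [[|n] [k [Lk fk ->]]]; first by exists k.
  exists (f (iter n (xi \o f) (xi k))) => //; apply/fL/ZX.
  by exists n, k.
have Zeta x : Z x -> Z (xi (f x)).
  by move=> [n [k [Lk fk ->]]]; exists n.+1, k.
have Zeta' x : X x -> Z (xi (f x)) -> Z x.
  move=> Xx [[|n] [k [Lk fk]]] /=; first by move=> /(xinj _ _ (fL _ Xx) Lk) /fk.
  have Zn : Z (iter n (xi \o f) (xi k)) by exists n, k.
  move=> /(xinj _ _ (fL _ Xx) (fL _ (ZX _ Zn))) /(finj _ _ Xx (ZX _ Zn)) ->.
  by [].
have /choice[lam Hlam] : forall x, exists l, X x -> L l /\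
    ((Z x /\ xi l = x) \/ (~ Z x /\ l = f x)).
  move=> x; have [Zx|nZ] := pselect (Z x).
    by have [l Ll xl] := ZL x Zx; exists l => _; split=> //; left.
  by exists (f x) => Xx; split; [exact: fL | right].
have lamE x l : X x -> L l -> (Z x /\ xi l = x) \/ (~ Z x /\ l = f x) -> lam x = l.
  move=> Xx Ll h; have [Lx [[Zx ex]|[nZx ex]]] := Hlam x Xx;
    case: h => [[Z' e']|[nZ' e']] //.
    by apply: xinj => //; rewrite ex.
  by rewrite ex.
have laminj x y : X x -> X y -> lam x = lam y -> x = y.
  move=> Xx Xy; have [_ hx] := Hlam x Xx; have [_ hy] := Hlam y Xy => e.
  case: hx hy => [[Zx ex]|[nZx ex]] [[Zy ey]|[nZy ey]].
  - by rewrite -ex -ey e.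
  - by case: nZy; apply: Zeta' => //; rewrite -ey -e ex.
  - by case: nZx; apply: Zeta' => //; rewrite -ex e ey.
  - by apply: finj => //; rewrite -ex -ey.
have /choice[lam' Hlam'] : forall l, exists x, L l -> X x /\ lam x = l.
  move=> l; have [Ll|nL] := pselect (L l); last by exists l.
  have [Zl|nZ] := pselect (Z (xi l)).
    by exists (xi l) => _; split; [exact: xiX|apply: lamE; auto].
  have [[x [Xx fx]]|nf] := pselect (exists x, X x /\ f x = l); last first.
    case: nZ; exists 0%N, l; split=> // y Xy fy; apply: nf; by exists y.
  exists x => _; split=> //; apply: lamE => //; right; split=> // Zx.
  by apply: nZ; rewrite -fx; apply: Zeta.
exists lam, lam'; split.
- by move=> x /Hlam[].
- by move=> l /Hlam'[].
- move=> x Xx; have [Lx _] := Hlam x Xx; have [Xl el] := Hlam' _ Lx.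
  exact: laminj.
- by move=> l /Hlam'[].
- move=> x Xx; have [Lx hx] := Hlam x Xx; apply: lamE.
  + exact/xiX/fL.
  + exact/fL/xiX.
  + by case: hx => [[Zx ->]|[nZx ->]]; [left|right]; split; auto.
Qed.

(** * A fast-growing shift for a suitable well-order *)

Section GrowingShift.
Variables (F : fieldType) (V : lmodType F) (u : {linear V -> V}).
Variables (X E : set V) (g : V -> nat -> V).
Hypothesis fX : free_pairs u X.
Hypothesis gE : forall v, spanned E v.
Hypothesis gX : forall x n, E x -> X (g x n).
Hypothesis ginj : forall x y n m, E x -> E y -> g x n = g y m -> x = y /\ n = m.

(** The order is lexicographic in the layer [r] and the index [q]. A layer meeting [E] contains
    infinitely many vectors [u (g l n)], and each of its points has only finitely many predecessors
    in it, so [xi] can be chosen by recursion on the index. *)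
Lemma growing_shift : exists (lt : V -> V -> Prop) (xi : V -> V),
  [/\ well_founded lt, (forall x y z, lt x y -> lt y z -> lt x z) &
      forall x y, [\/ lt x y, x = y | lt y x]] /\
  [/\ forall l, (E `\` X) l -> X (xi l) /\ lt l (u (xi l)),
      forall l m, (E `\` X) l -> (E `\` X) m -> lt l m -> lt (u (xi l)) (u (xi m)) &
      forall l, (E `\` X) l ->
        spanned (X `|` [set m | (E `\` X) m /\ lt m (u (xi l))]) (u l)].
Proof.
have /choice[supp Hsupp] : forall v, exists s : seq V,
    (forall y, y \in s -> E y) /\ spanned [set y | y \in s] (u v).
  by move=> v; apply: spanned_seq.
pose G l n := u (g l n).
have Ginj x y n m : E x -> E y -> G x n = G y m -> x = y /\ n = m.
  by move=> Ex Ey /(free_pairs_inj fX (gX n Ex) (gX m Ey)) /ginj; apply.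
(* Supports must not climb to higher layers, and [G x n] must share the layer of [x], hence the two
   directions. The backward one is countable because [G] is injective. *)
have [|lt [r [q [wf trans tot Rr rq]]]] := @countable_filtration V
    (fun x => [set y | y \in supp x] `|` (range (G x) `|` [set y | E y /\ range (G y) x])).
  move=> x; apply: countableU; first exact/finite_set_countable/finite_seq.
  apply: countableU; first exact: card_image_le.
  apply/countable_injP; exists (fun=> 0%N) => y z; rewrite !inE.
  by move=> [Ey [n _ Gyn]] [Ez [m _ Gzm]] _; apply: (Ginj _ _ n m _ _ _).1; rewrite // Gyn.
have rG x n : E x -> r (G x n) = r x.
  move=> Ex; have h1 : ~ lt (r x) (r (G x n)).
    by apply: Rr; right; left; exists n.
  have h2 : ~ lt (r (G x n)) (r x) by apply: Rr; right; right; split=> //; exists n.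
  by case: (tot (r x) (r (G x n))).
have /choice[pick Hpick] : forall kN : V * nat, exists x, (exists2 l, E l & r l = kN.1) ->
    [/\ X x, r (u x) = kN.1 & (kN.2 < q (u x))%N].
  move=> [k N]; have [[l El rl]|nl] := pselect (exists2 l, E l & r l = k); last by exists 0.
  have [|n Nn] := @injective_nat_unbounded (q \o G l) N.
    move=> a b /= qab; apply: (Ginj _ _ _ _ El El _).2.
    by apply: rq => //; rewrite !rG.
  by exists (g l n) => _; split=> //; [exact: gX | rewrite -rl; apply: rG].
(* The bound may depend on layer and index only, since together they determine [l]. *)
have /choice[bnd Hbnd] : forall kn : V * nat, exists N, forall l,
    r l = kn.1 -> q l = kn.2 -> forall y, y \in supp l -> (q y <= N)%N.
  move=> [k n]; have [[l [rl ql]]|nl] := pselect (exists l, r l = k /\ q l = n).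
    exists (\max_(y <- supp l) q y)%N => m rm qm y; have -> : m = l.
      by apply: rq; rewrite ?rm ?qm.
    by move=> ys; apply: leq_bigmax_seq.
  by exists 0%N => l rl ql; case: nl; exists l.
(* The index of [u (h k n)] exceeds [n], to lie above [l]; [bnd], to lie above the support of [u l];
   and the previous value, for monotonicity. *)
pose h k := fix h n := pick (k, maxn n (maxn (bnd (k, n))
  (if n is m.+1 then q (u (h m)) else 0%N))).
have hP k n : (exists2 l, E l & r l = k) ->
    [/\ X (h k n), r (u (h k n)) = k, (n < q (u (h k n)))%N,
        (bnd (k, n) < q (u (h k n)))%N &
        forall m, n = m.+1 -> (q (u (h k m)) < q (u (h k n)))%N].
  move=> /(Hpick (k, maxn n (maxn (bnd (k, n))
    (if n is m.+1 then q (u (h k m)) else 0%N)))).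
  have -> : pick (k, maxn n (maxn (bnd (k, n))
    (if n is m.+1 then q (u (h k m)) else 0%N))) = h k n by case: n.
  move=> /= [Xh rh]; rewrite !gtn_max => /and3P[qh bh hm]; split=> // m nm.
  by subst n.
have hmono k n m : (exists2 l, E l & r l = k) -> (n < m)%N ->
    (q (u (h k n)) < q (u (h k m)))%N.
  move=> hk; apply: (@homo_ltn _ (fun i => q (u (h k i)))
    (fun a b => (a < b)%N)) => [y x z|i].
    exact: ltn_trans.
  by have [_ _ _ _] := hP k i.+1 hk; apply.
pose slt x y := lt (r x) (r y) \/ r x = r y /\ (q x < q y)%N.
exists slt, (fun l => h (r l) (q l)); split; split.
- exact: well_founded_lex.
- move=> x y z [xy|[xy qxy]] [yz|[yz qyz]].
  + by left; apply: trans yz.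
  + by left; rewrite -yz.
  + by left; rewrite xy.
  + by right; split; [rewrite xy | apply: ltn_trans qyz].
- move=> x y; case: (tot (r x) (r y)) => rxy.
  + by constructor 1; left.
  + case: (ltngtP (q x) (q y)) => qxy.
    * by constructor 1; right.
    * by constructor 3; right.
    * by constructor 2; apply: rq.
  + by constructor 3; left.
- move=> l [El _]; have [|Xh rh qh _ _] := hP (r l) (q l); first by exists l.
  by split=> //; right; rewrite rh.
- move=> l m [El _] [Em _] lm.
  have [|_ rl _ _ _] := hP (r l) (q l); first by exists l.
  have [|_ rm _ _ _] := hP (r m) (q m); first by exists m.
  rewrite /slt rl rm; case: lm => [|[rlm qlm]]; first by left.
  by right; split=> //; rewrite -rlm; apply: hmono => //; exists l.
- move=> l [El _]; have [sE su] := Hsupp l.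
  apply: spanned_mono su => y /= ys.
  have [Xy|nXy] := pselect (X y); first by left.
  right; split; first by split=> //; apply: sE.
  have [|_ rl _ bl _] := hP (r l) (q l); first by exists l.
  rewrite /slt rl; case: (tot (r l) (r y)) => rly.
  + by case: (Rr l y) => //; left.
  + by right; split=> //; apply: leq_ltn_trans bl; apply: (Hbnd (r l, q l) l).
  + by left.
Qed.

End GrowingShift.

(** * Inversion of unitriangular maps *)

Section InverseLinear.
Variables (F : fieldType) (V : lmodType F) (f : {linear V -> V}).

Lemma linear_inverse : (forall v, f v = 0 -> v = 0) -> (forall v, exists w, f w = v) ->
  exists g : {linear V -> V}, cancel f g /\ cancel g f.
Proof.
move=> f0 /choice[g gK]; have fK : cancel f g.
  move=> v; apply/eqP; rewrite -subr_eq0; apply/eqP/f0.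
  by rewrite linearB /= gK subrr.
have glin : linear g by exact: can2_linear fK gK.
pose lg := GRing.isLinear.Build F V V *:%R g glin.
pose gL : {linear V -> V} := HB.pack g lg.
by exists gL.
Qed.

End InverseLinear.

Section Triangular.
Variables (F : fieldType) (V : lmodType F) (X E : set V) (lt : V -> V -> Prop).
Hypothesis XE : X `<=` E.
Hypothesis iE : indep E.
Hypothesis gE : forall v, spanned E v.
Hypothesis wf : well_founded lt.
Hypothesis trans : forall x y z, lt x y -> lt y z -> lt x z.
Hypothesis tot : forall x y, [\/ lt x y, x = y | lt y x].

Let L := E `\` X.

(** [X] counts as lower than every [l]: only [L] is graded by the order. *)
Definition below (l : V) := X `|` [set m | L m /\ lt m l].

Lemma sub_below l m : lt l m -> below l `<=` below m.
Proof. by move=> lm x [Xx|[Lx xl]]; [left|right; split=> //; apply: trans lm]. Qed.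

Lemma below_notin l : L l -> ~ spanned (below l) l.
Proof.
move=> [El nXl] h; apply: (iE El); apply: spanned_mono h.
move=> x [Xx|[[Ex _] xl]]; split; [exact: XE | by move=> /= xl; rewrite xl in Xx | by [] |].
move=> /= e; rewrite e in xl; move: xl.
by elim/(well_founded_ind wf): l {El nXl e} => l IH ll; apply: (IH l).
Qed.

Lemma leading_index (D : set V) v : D `<=` L -> spanned (X `|` D) v ->
  spanned X v \/ exists2 l, D l & spanned (below l `|` [set l]) v.
Proof.
move=> DL; elim=> [|a s w Xs _ [IH|[l Dl IH]]]; first by left; apply: spanned0.
  case: Xs => [Xs|Ds]; first by left; apply: spanned_cons.
  right; exists s => //; apply: spanned_cons; first by right.
  by apply: spanned_mono IH => x Xx; left; left.
right; case: Xs => [Xs|Ds].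
  by exists l => //; apply: spanned_cons => //; left; left.
case: (tot s l) => sl.
- by exists l => //; apply: spanned_cons => //; left; right; split=> //; apply: DL.
- by exists l => //; apply: spanned_cons => //; right; rewrite sl.
- exists s => //; apply: spanned_cons; first by right.
  apply: spanned_mono IH => x [xl|->]; left; first exact: sub_below xl.
  by right; split=> //; apply: DL.
Qed.

(** Take the least [l] with [v] in the span of [below l] and [l]. A zero coefficient would give a
    smaller one, by [leading_index] applied to the predecessors of [l]. *)
Lemma leading_term v : spanned X v \/
  exists l c, [/\ L l, c != 0 & spanned (below l) (v - c *: l)].
Proof.
have [XL|XL] := pselect (spanned X v); [by left | right].
have [|/XL[]|[l0 Ll0 vl0]] := @leading_index L v (fun _ h => h).
  apply: spanned_mono (gE v) => x Ex.
  by have [Xx|nXx] := pselect (X x); [left|right].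
have [l [Ll vl] lmin] := well_founded_min
  (P := [set l | L l /\ spanned (below l `|` [set l]) v]) wf (conj Ll0 vl0).
have [c hc] := spanned_setU1 vl; exists l, c; split=> //.
apply/eqP => c0; rewrite c0 scale0r subr0 in hc.
have [|/XL[]|[m [Lm ml] vm]] := @leading_index [set m | L m /\ lt m l] v _ hc.
  by move=> m [].
by apply: (lmin m).
Qed.

(** [f] preserves leading terms, hence is injective. Surjectivity is by well-founded induction, as
    [f y - y] involves only lower vectors. *)
Lemma unitriangular_inverse (f : {linear V -> V}) :
  (forall x, X x -> f x = x) ->
  (forall l, L l -> spanned (below l) (f l - l)) ->
  exists g : {linear V -> V}, cancel f g /\ cancel g f.
Proof.
move=> fX fL; apply: linear_inverse => v.
  have fbelow l x : spanned (below l) x -> spanned (below l) (f x).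
    apply: (@linear_spanned _ _ _ f _ (spanned (below l))); first exact: spanned0.
      by move=> a s t hs ht; apply: spannedD => //; apply: spannedZ.
    move=> y [Xy|[Ly yl]]; first by rewrite fX //; apply: spanned_incl; left.
    apply: (@spannedBr _ _ _ _ y); last by apply: spanned_incl; right.
    by apply: spanned_mono (fL y Ly); apply: sub_below.
  move=> fv0; have [Xv|[l [c [Ll c0 hv]]]] := leading_term v.
    rewrite -fv0; apply: esym.
    by apply: (@linear_eq_spanned _ _ _ f idfun X) Xv => x /fX.
  case: (below_notin Ll); apply: (spannedZr c0).
  have := fbelow _ _ hv; rewrite linearB fv0 sub0r linearZ /= => /spannedN.
  rewrite opprK => h; have := spannedB h (spannedZ c (fL l Ll)).
  by rewrite scalerBr opprB addrCA subrr addr0.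
have Im : forall x, spanned E x -> exists w, f w = x.
  move=> x; apply: (@linear_spanned _ _ _ idfun E (fun x => exists w, f w = x)).
  - by exists 0; rewrite linear0.
  - by move=> a y z [y' <-] [z' <-]; exists (a *: y' + z'); rewrite linearP.
  move=> y Ey /=; have [Xy|nXy] := pselect (X y); first by exists y; apply: fX.
  elim/(well_founded_ind wf): y Ey nXy => y IH Ey nXy.
  have [w fw] : exists w, f w = f y - y; last by exists (y - w); rewrite linearB fw subKr.
  apply: (@linear_spanned _ _ _ idfun _ (fun x => exists w, f w = x)) (fL y _) => //.
  - by exists 0; rewrite linear0.
  - by move=> a s t [s' <-] [t' <-]; exists (a *: s' + t'); rewrite linearP.
  - by move=> z [/fX fz|[[Ez nXz] zy]] /=; [exists z | apply: IH].
exact: Im.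
Qed.

End Triangular.

(** * Recursion along the orbits of a shift *)

Inductive orbit (V : Type) (L : set V) (rho T kap : V -> V) : V -> V -> Prop :=
| orbit_start l : L l -> (forall m, L m -> rho m <> l) -> orbit L rho T kap l (kap l)
| orbit_step l v : L l -> orbit L rho T kap l v -> orbit L rho T kap (rho l) (T v).

(** Since [rho] increases a well-founded order, every backward orbit stops, so a value exists;
    injectivity of [rho] makes it unique. *)
Lemma orbit_function (V : choiceType) (L : set V) (lt : V -> V -> Prop)
    (rho T kap : V -> V) :
  well_founded lt -> (forall l, L l -> L (rho l)) -> (forall l, L l -> lt l (rho l)) ->
  (forall l m, L l -> L m -> rho l = rho m -> l = m) ->
  exists beta : V -> V, (forall l, L l -> orbit L rho T kap l (beta l)) /\
    forall l, L l -> beta (rho l) = T (beta l).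
Proof.
move=> wf rhoL lrho rinj.
have ex l : L l -> exists v, orbit L rho T kap l v.
  elim/(well_founded_ind wf): l => l IH Ll.
  have [[m [Lm ml]]|nm] := pselect (exists m, L m /\ rho m = l).
    have [|v hv] := IH m _ Lm; first by rewrite -ml; apply: lrho.
    by exists (T v); rewrite -ml; apply: orbit_step.
  by exists (kap l); apply: orbit_start => // m Lm ml; apply: nm; exists m.
have uniq l v w : orbit L rho T kap l v -> orbit L rho T kap l w -> v = w.
  move=> h; elim: h w => {l v} [l Ll nl|l v Ll _ IH] w hw.
    by case: l w / hw Ll nl => // l w Ll _ _ /(_ l Ll).
  have [m em] : exists m, m = rho l by exists (rho l).
  rewrite -em in hw; case: m w / hw em => [m Lm nm|m w Lm hw] em.
    by case: (nm l Ll).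
  by rewrite (IH w) //; rewrite -(rinj _ _ Lm Ll em).
have /choice[beta Hb] : forall l, exists v, L l -> orbit L rho T kap l v.
  by move=> l; have [/ex[v hv]|nL] := pselect (L l); [exists v | exists l].
exists beta; split=> // l Ll; apply: uniq (Hb _ (rhoL _ Ll)) _.
by apply: orbit_step => //; apply: Hb.
Qed.

(** * Construction of the projection and of the similarity *)

Section Assembly.
Variables (F : fieldType) (V : lmodType F) (u : {linear V -> V}) (gam : F).
Variables (X E : set V) (lt : V -> V -> Prop) (xi : V -> V).
Hypothesis fX : free_pairs u X.
Hypothesis uXE : with_image u X `<=` E.
Hypothesis iE : indep E.
Hypothesis gE : forall v, spanned E v.
Hypothesis wf : well_founded lt.
Hypothesis trans : forall x y z, lt x y -> lt y z -> lt x z.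
Hypothesis tot : forall x y, [\/ lt x y, x = y | lt y x].
Let L := E `\` X.
Hypothesis xiX : forall l, L l -> X (xi l) /\ lt l (u (xi l)).
Hypothesis rho_mono : forall l m, L l -> L m -> lt l m -> lt (u (xi l)) (u (xi m)).
Hypothesis u_below : forall l, L l -> spanned (below X E lt (u (xi l))) (u l).

Lemma block_data : exists kap Phi Psi : {linear V -> V},
  [/\ forall x, kap (kap x) = kap x, forall x, kap (Phi x) = Phi x &
      forall x, Psi (kap x) = Psi x] /\
  [/\ forall x, kap (Psi x) = 0, forall x, Psi (Phi x) = x - kap x,
      forall x, Phi (Psi x) = kap x &
      forall x, kap x = 0 -> Phi (u x) = gam *: Phi x - kap (u (Phi x))].
Proof.
have XE : X `<=` E by move=> x Xx; apply: uXE; left.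
have uL x : X x -> L (u x).
  move=> Xx; split; first by apply: uXE; right; exists x.
  by move=> Xux; apply: (free_pairs_disjoint fX Xx Xux).
have irr x : ~ lt x x.
  by elim/(well_founded_ind wf): x => x IH xx; apply: (IH x).
have xi_inj l m : L l -> L m -> xi l = xi m -> l = m.
  move=> Ll Lm e; case: (tot l m) => // h; have := rho_mono _ _ h.
    by rewrite e => /(_ Ll Lm)/irr.
  by rewrite e => /(_ Lm Ll)/irr.
pose rho l := u (xi l).
have rhoL l : L l -> L (rho l) by move=> /xiX[/uL].
have rho_inj l m : L l -> L m -> rho l = rho m -> l = m.
  move=> Ll Lm /(free_pairs_inj fX (xiX Ll).1 (xiX Lm).1); exact: xi_inj.
have case_E e : E e -> X e \/ L e.
  by move=> Ee; have [Xe|nXe] := pselect (X e); [left|right].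
have XB l x : X x -> spanned (below X E lt l) x by move=> Xx; apply: spanned_incl; left.
have LB l m : L m -> lt m l -> spanned (below X E lt l) m.
  by move=> Lm ml; apply: spanned_incl; right.
have spanB S : forall a (v w : V), spanned S v -> spanned S w -> spanned S (a *: v + w).
  by move=> a v w Sv Sw; apply: spannedD => //; apply: spannedZ.
(* The projection with kernel the span of [X] and image the span of the vectors [l - xi l]. *)
have [kap Hkap] := @linear_extension _ _ V E
  (fun v => if `[< X v >] then 0 else v - xi v) iE gE.
have kapX x : X x -> kap x = 0.
  by move=> Xx; rewrite Hkap; [case: asboolP | exact: XE].
have kapL l : L l -> kap l = l - xi l.
  by move=> [El nXl]; rewrite Hkap //; case: asboolP.
have kapK x : kap (kap x) = kap x.
  apply: (@linear_eq_spanned _ _ _ (kap \o kap) kap E) (gE x) => e /case_E[Xe|Le] /=.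
    by rewrite (kapX _ Xe) linear0.
  by rewrite (kapL _ Le) linearB /= (kapL _ Le) (kapX (xi e)) ?subr0 //; apply: (xiX Le).1.
pose pi : {linear V -> V} := idfun \- kap.
have piE x : pi x = x - kap x by [].
have piX x : X x -> pi x = x by move=> Xx; rewrite piE kapX // subr0.
have pi_span x : spanned X (pi x).
  apply: (@linear_spanned _ _ _ pi E (spanned X)) (gE x); [exact: spanned0|exact: spanB|].
  move=> e /case_E[Xe|Le]; first by rewrite piX //; apply: spanned_incl.
  by rewrite piE kapL // subKr; apply/spanned_incl/(xiX Le).1.
(* On the image of [kap], [T] is [gam] minus the compression of [u]. *)
pose T : {linear V -> V} := kap \o ((gam \*: kap) \- (u \o kap)).
have TE v : T v = kap (gam *: kap v - u (kap v)) by [].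
have TX x : X x -> T x = 0.
  by move=> Xx; rewrite TE (kapX _ Xx) scaler0 (linear0 u) subr0 linear0.
(* The term [- u (- xi l)] contributes [rho l]; the terms in [l], [u l] and the span of [X] are all
   lower, by the growth of the shift. *)
have TL l : L l -> spanned (below X E lt (rho l)) (T l - rho l).
  move=> Ll; have [Xxl llt] := xiX Ll.
  have -> : T l - rho l = gam *: (l - xi l) - u l - pi (gam *: (l - xi l) - u (l - xi l)).
    rewrite TE (kapL _ Ll) piE; set w := gam *: _ - u (l - xi l).
    have -> : gam *: (l - xi l) - u l = w - rho l.
      by rewrite /w (linearB u) opprB addrA addrAC addrK.
    by rewrite opprB addrCA; congr (_ + _); rewrite addrAC subrr sub0r.
  apply: spannedB; last by apply: spanned_mono (pi_span _) => x; left.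
  apply: spannedB; last exact: u_below.
  by apply/spannedZ/spannedB; [exact: LB | exact: XB].
have Tbelow l v : L l -> spanned (below X E lt l) v -> spanned (below X E lt (rho l)) (T v).
  move=> Ll.
  apply: (@linear_spanned _ _ _ T _ (spanned _)); [exact: spanned0|exact: spanB|].
  move=> m [Xm|[Lm ml]]; first by rewrite TX //; apply: spanned0.
  have mono := rho_mono Lm Ll ml.
  apply: (@spannedBr _ _ _ _ (rho m)); last by apply: LB => //; apply: rhoL.
  by apply: spanned_mono (TL _ Lm); apply: sub_below.
have [beta [borb bT]] := @orbit_function V L lt rho T kap wf rhoL
  (fun l Ll => (xiX Ll).2) rho_inj.
(* The values of [beta] lie in the image of [kap] and have leading term [l], so [Th] below is
   unitriangular. *)
have borbP l v : orbit L rho T kap l v -> kap v = v /\ spanned (below X E lt l) (v - l).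
  elim=> {l v} [l Ll _|l v Ll _ [kv hv]].
    split; first exact: kapK.
    by rewrite kapL // addrC addKr; apply/spannedN/XB/(xiX Ll).1.
  split; first by rewrite TE kapK.
  have -> : T v - rho l = T (v - l) + (T l - rho l) by rewrite (linearB T) addrA subrK.
  by apply: spannedD; [exact: Tbelow | exact: TL].
have kb l : L l -> kap (beta l) = beta l by move=> Ll; have [] := borbP _ _ (borb l Ll).
have bl l : L l -> spanned (below X E lt l) (beta l - l).
  by move=> Ll; have [] := borbP _ _ (borb l Ll).
have [Th HTh] := @linear_extension _ _ V E
  (fun v => if `[< X v >] then v else beta v) iE gE.
have ThX x : X x -> Th x = x.
  by move=> Xx; rewrite HTh; [case: asboolP | exact: XE].
have ThL l : L l -> Th l = beta l.
  by move=> [El nXl]; rewrite HTh //; case: asboolP.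
have [|Ti [ThK TiK]] := unitriangular_inverse XE iE gE wf trans tot ThX.
  by move=> l Ll; rewrite ThL //; apply: bl.
have [lam [lam' [lamL lamX lamK lamK' lamC]]] := @equivariant_schroeder_bernstein V X L u xi
  uL (fun l Ll => (xiX Ll).1)
  (fun x y Xx Xy => @free_pairs_inj _ _ _ _ x y fX Xx Xy) xi_inj.
have [La HLa] := @linear_extension _ _ V E
  (fun v => if `[< X v >] then lam v else 0) iE gE.
have LaX x : X x -> La x = lam x.
  by move=> Xx; rewrite HLa; [case: asboolP | exact: XE].
have LaL l : L l -> La l = 0.
  by move=> [El nXl]; rewrite HLa //; case: asboolP.
have [Li HLi] := @linear_extension _ _ V E
  (fun v => if `[< X v >] then 0 else lam' v) iE gE.
have LiX x : X x -> Li x = 0.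
  by move=> Xx; rewrite HLi; [case: asboolP | exact: XE].
have LiL l : L l -> Li l = lam' l.
  by move=> [El nXl]; rewrite HLi //; case: asboolP.
(* [lam] carries [xi] after [u] on [X] to the shift [rho] on [L], and [Th] carries [rho] to [T]
   because [beta (rho l) = T (beta l)]. *)
pose Phi : {linear V -> V} := Th \o La \o pi.
pose Psi : {linear V -> V} := Li \o Ti \o kap.
have PhiE x : Phi x = Th (La (pi x)) by [].
have PsiE x : Psi x = Li (Ti (kap x)) by [].
have kapThLa x : kap (Th (La x)) = Th (La x).
  apply: (@linear_eq_spanned _ _ _ (kap \o Th \o La) (Th \o La) E) (gE x).
  move=> e /case_E[Xe|Le] /=.
    by rewrite LaX // ThL ?kb //; apply: lamL.
  by rewrite LaL // !linear0.
have kapLi x : kap (Li x) = 0.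
  apply: (@linear_spanned _ _ _ (kap \o Li) E (fun v => v = 0)) (gE x) => //.
    by move=> a v w -> ->; rewrite scaler0 addr0.
  move=> e /case_E[Xe|Le] /=; first by rewrite LiX // linear0.
  by rewrite LiL // kapX //; apply: lamX.
exists kap, Phi, Psi; split; split=> //.
- by move=> x; rewrite PhiE kapThLa.
- by move=> x; rewrite !PsiE kapK.
- by move=> x; rewrite PsiE kapLi.
- move=> x; rewrite PsiE PhiE kapThLa ThK -piE.
  apply: (@linear_eq_spanned _ _ _ (Li \o La) idfun X) (pi_span x) => y Xy /=.
  by rewrite LaX // LiL ?lamK //; apply: lamL.
- move=> x; rewrite -(TiK x).
  apply: (@linear_eq_spanned _ _ _ (Phi \o Psi \o Th) (kap \o Th) E) (gE _) => e.
  move=> /case_E[Xe|Le]; rewrite /comp /=.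
    by rewrite (ThX _ Xe) -[LHS]/(Phi (Psi e)) PsiE (kapX _ Xe) !linear0.
  rewrite -[LHS]/(Phi (Psi (Th e))) PsiE ThL // kb // -ThL // ThK LiL // PhiE.
  by rewrite piX ?LaX ?lamK' //; apply: lamX.
- move=> x kx; have -> : x = pi x by rewrite piE kx subr0.
  apply: (@linear_eq_spanned _ _ _ (Phi \o u)
    ((gam \*: Phi) \- (kap \o u \o Phi)) X) (pi_span x).
  move=> y Xy; rewrite -[LHS]/(Phi (u y)) -[RHS]/(gam *: Phi y - kap (u (Phi y))).
  have Pl z : X z -> Phi z = beta (lam z).
    by move=> Xz; rewrite PhiE piX // LaX // ThL //; apply: lamL.
  have Lly := lamL _ Xy.
  (* Since [u y] is in [L], its component in the span of [X] is [xi (u y)]. *)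
  rewrite {1}PhiE piE kapL ?subKr; last exact: uL.
  have Xxy : X (xi (u y)) by apply: (xiX (uL _ Xy)).1.
  rewrite LaX // lamC // ThL; last exact: rhoL.
  by rewrite bT // Pl // TE linearB linearZ /= !kb.
Qed.

End Assembly.

Theorem theorem2 (F : fieldType) (V : lmodType F) (u : {linear V -> V})
  (p1 p2 p3 : {poly F}) :
  infinite_dim V ->
  (forall lambda : F, ~ dominant_eigenvalue u lambda) ->
  split_deg2 p1 -> split_deg2 p2 -> split_deg2 p3 ->
  is_sum3 p1 p2 p3 u.
Proof.
move=> infV ndom /(@split_deg2_quadratic _ V)[a1 [b1 q1]]
  /(@split_deg2_quadratic _ V)[a2 [b2 q2]]
  /(@split_deg2_quadratic _ V)[a3 [b3 q3]].
have [X [E [g [[fX XE iE gE] [gX ginj]]]]] := large_free_pairs infV ndom.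
have [lt [xi [[wf trans tot] [xiX rho_mono u_below]]]] := growing_shift fX gE gX ginj.
have [kap [Phi [Psi [[h1 h2 h3] [h4 h5 h6 h7]]]]] :=
  block_data (a1 + b2 + (b1 + a2) + (a3 + b3)) fX XE iE gE wf trans tot
    xiX rho_mono u_below.
have [v1 [v2 [v3 [hu hq1 hq2 hq3]]]] :=
  quadratic_decomposition h1 h2 h3 h4 h5 h6 h7.
by exists v1, v2, v3; split=> //; split; [exact: q1 | split; [exact: q2 | exact: q3]].
Qed.
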